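(* Let $p\ge q\ge1$. Let $Q_1:\mathbb{R}^{d_0}\to\mathbb{R}^{d_1}$ and $Q_2:\mathbb{R}^{d_0}\to\mathbb{R}^{d_2}$ be measurable. Fix a measurable partition $U_1,\dots,U_l$ of $[0,1]^{d_0}$ and a measurable set $B\subset\mathbb{R}^{d_0+d_1}$. For measurable $U\subset\mathbb{R}^{d_0}$ define $E^{(1)}_Ug(x_0,x_1)=\int_U g(u)e(x_0\cdot u+x_1\cdot Q_1(u))\,du$ and $E^{(2)}_Uh(x_0,x_1,x_2)=\int_U h(u)e(x_0\cdot u+x_1\cdot Q_1(u)+x_2\cdot Q_2(u))\,du$, where $x_i\in\mathbb{R}^{d_i}$ and $e(z)=e^{2\pi iz}$. Suppose $C$ is a number such that $\|E^{(1)}_{[0,1]^{d_0}}g\|_{L^p(B)}\le C\big(\sum_i\|E^{(1)}_{U_i}g\|_{L^p(B)}^q\big)^{1/q}$ for all measurable $g$. Then for every measurable $B'\subset\mathbb{R}^{d_2}$ and every measurable $h$, $\|E^{(2)}_{[0,1]^{d_0}}h\|_{L^p(B\times B')}\le C\big(\sum_i\|E^{(2)}_{U_i}h\|_{L^p(B\times B')}^q\big)^{1/q}$. *)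

(* Defs.v *)
From HB Require Import structures.
From mathcomp Require Import all_boot all_order all_algebra.
From mathcomp Require Import all_classical all_reals all_analysis.
From mathcomp Require Import complex.

Set Implicit Arguments.
Unset Strict Implicit.
Unset Printing Implicit Defensive.

Import Order.TTheory GRing.Theory Num.Theory.
Import numFieldNormedType.Exports.

Local Open Scope classical_set_scope.
Local Open Scope ring_scope.

Section prod_sf.
Local Open Scope ereal_scope.
Context d1 d2 (T1 : measurableType d1) (T2 : measurableType d2) (R : realType).
Variable m1 : {sigma_finite_measure set T1 -> \bar R}.
Variable m2 : {sigma_finite_measure set T2 -> \bar R}.
Definition pmeas := (m1 \x m2)%E.
HB.instance Definition _ := Measure.copy pmeas (m1 \x m2)%E.

Lemma pm_sigma_finite : sigma_finite setT pmeas.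
Proof.
have /sigma_finiteP[F [TF ndF Foo]] := sigma_finiteT m1.
have /sigma_finiteP[G [TG ndG Goo]] := sigma_finiteT m2.
exists (fun n => F n `*` G n).
 rewrite -setXTT TF TG predeqE => -[x y]; split.
    move=> [/= [n _ Fnx] [k _ Gky]]; exists (maxn n k) => //; split.
    - by move: x Fnx; exact/subsetPset/ndF/leq_maxl.
    - by move: y Gky; exact/subsetPset/ndG/leq_maxr.
  by move=> [n _ []/= ? ?]; split; exists n.
move=> k; have [? ?] := Foo k; have [? ?] := Goo k.
split; first exact: measurableX.
by rewrite /pmeas product_measure1E// lte_mul_pinfty// ge0_fin_numE.
Qed.

HB.instance Definition _ := Measure_isSigmaFinite.Build _ _ _ pmeas
  pm_sigma_finite.
End prod_sf.
Arguments pmeas {d1 d2 T1 T2 R} m1 m2.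

(* Euclidean space R^n with its Borel sigma-algebra (iterated product),
   its Lebesgue measure (iterated product of 1-dimensional Lebesgue measures),
   its dot product, and the unit cube [0,1]^n. *)
Record space (R : realType) := Space {
  sp_disp : measure_display;
  sp_type : measurableType sp_disp;
  sp_leb  : {sigma_finite_measure set sp_type -> \bar R};
  sp_dot  : sp_type -> sp_type -> R;
  sp_cube : set sp_type }.

Fixpoint Rspace (R : realType) (n : nat) : space R :=
  match n with
  | 0 => @Space R _ unit (\d_ tt) (fun _ _ => 0) setT
  | n'.+1 =>
      let S := Rspace R n' in
      @Space R _ _
        (pmeas (@lebesgue_measure R) (@sp_leb R S))
        (fun x y => x.1 * y.1 + @sp_dot R S x.2 y.2)
        (`[0%R, 1%R]%classic `*` @sp_cube R S)
  end.

Definition Rn (R : realType) (n : nat) := @sp_type R (Rspace R n).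
Definition lebn (R : realType) (n : nat) := @sp_leb R (Rspace R n).
Definition dotn (R : realType) (n : nat) : Rn R n -> Rn R n -> R :=
  @sp_dot R (Rspace R n).
Definition cube (R : realType) (n : nat) : set (Rn R n) := @sp_cube R (Rspace R n).

Arguments Rn : clear implicits.
Arguments lebn : clear implicits.
Arguments cube : clear implicits.

Local Open Scope complex_scope.

Definition ee (R : realType) (z : R) : R[i] :=
  (cos (2 * pi * z)) +i* (sin (2 * pi * z)).

Definition cmod (R : realType) (z : R[i]) : R :=
  Num.sqrt (complex.Re z ^+ 2 + complex.Im z ^+ 2).

Definition cintegral (R : realType) (n : nat) (U : set (Rn R n))
    (f : Rn R n -> R[i]) : R[i] :=
  (Rintegral (lebn R n) U (fun u => complex.Re (f u)))
  +i* (Rintegral (lebn R n) U (fun u => complex.Im (f u))).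

Definition cmeasurable (R : realType) (n : nat) (f : Rn R n -> R[i]) :=
  measurable_fun setT (fun u => complex.Re (f u)) /\
  measurable_fun setT (fun u => complex.Im (f u)).

Definition cintegrable (R : realType) (n : nat) (D : set (Rn R n))
    (f : Rn R n -> R[i]) :=
  (lebn R n).-integrable D (fun u => (complex.Re (f u))%:E) /\
  (lebn R n).-integrable D (fun u => (complex.Im (f u))%:E).

Definition E1 (R : realType) (d0 d1 : nat) (Q1 : Rn R d0 -> Rn R d1)
    (U : set (Rn R d0)) (g : Rn R d0 -> R[i]) (x : Rn R d0 * Rn R d1) : R[i] :=
  cintegral U (fun u => g u * ee (dotn x.1 u + dotn x.2 (Q1 u))).

Definition E2 (R : realType) (d0 d1 d2 : nat) (Q1 : Rn R d0 -> Rn R d1)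
    (Q2 : Rn R d0 -> Rn R d2) (U : set (Rn R d0)) (h : Rn R d0 -> R[i])
    (x : (Rn R d0 * Rn R d1) * Rn R d2) : R[i] :=
  cintegral U (fun u =>
    h u * ee (dotn x.1.1 u + dotn x.1.2 (Q1 u) + dotn x.2 (Q2 u))).

Local Close Scope complex_scope.

Definition LpnormC (R : realType) (dd : measure_display) (T : measurableType dd)
    (mu : {measure set T -> \bar R}) (p : R) (B : set T) (F : T -> R[i])
    : \bar R :=
  Lnorm mu p%:E (fun x => (\1_B x * cmod (F x))%:E).

(* Main.v *)
Require Import Defs.
From HB Require Import structures.
From mathcomp Require Import all_boot all_order all_algebra.
From mathcomp Require Import all_classical all_reals all_analysis.
From mathcomp Require Import complex.
From mathcomp Require Import measurable_realfun.
From mathcomp Require Import ring.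

(** Fix the last variable x2.  As e is a character, the slice E^(2)_U h (., x2)
    is E^(1)_U g with g = h e(x2 . Q2(.)), so the hypothesis applied to g bounds
    the p-th powers I_U(x2) of the L^p(B) norms of the slices:
    I_[0,1]^d0(x2)^(1/p) <= C (sum_i I_(U_i)(x2)^(q/p))^(1/q) for x2 in B'.
    By Tonelli the p-th power of the L^p(B x B') norm of E^(2)_U h is the
    integral of I_U, so it remains to raise the pointwise bound to the power p,
    integrate it, and apply Minkowski's inequality in L^(p/q) (p/q >= 1) to the
    sum of the I_(U_i)^(q/p). *)

Set Implicit Arguments.
Unset Strict Implicit.
Unset Printing Implicit Defensive.

Import Order.TTheory GRing.Theory Num.Theory.
Import numFieldNormedType.Exports.

Local Open Scope classical_set_scope.
Local Open Scope ring_scope.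

Lemma measurable_cube (R : realType) n : measurable (cube R n).
Proof. by elim: n => [|n IH]; [exact: measurableT | exact: measurableX]. Qed.

Lemma measurable_dotn (R : realType) n d (X : measurableType d)
    (f g : X -> Rn R n) :
  measurable_fun setT f -> measurable_fun setT g ->
  measurable_fun setT (fun x => dotn (f x) (g x)).
Proof.
elim: n d X f g => [|n IH] d X f g mf mg; first exact: measurable_cst.
apply: measurable_funD.
  by apply: measurable_funM; exact: measurableT_comp.
by apply: IH; exact: measurableT_comp.
Qed.

Lemma indic_setX (T1 T2 : Type) (R : realType) (A : set T1) (A' : set T2) a b :
  \1_(A `*` A') (a, b) = \1_A a * \1_A' b :> R.
Proof.
rewrite !indicE; have [Aa|nAa] := boolP (a \in A); last first.
  by rewrite mul0r memNset // => -[/mem_set]; rewrite (negbTE nAa).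
have [Ab|nAb] := boolP (b \in A'); last first.
  by rewrite mulr0 memNset // => -[_ /mem_set]; rewrite (negbTE nAb).
by rewrite mulr1 mem_set //; split; exact: set_mem.
Qed.

Lemma measurable_fun_Rintegral_snd (R : realType) d (X : measurableType d)
    d' (Y : measurableType d') (m : {sigma_finite_measure set Y -> \bar R})
    (V : set Y) (k : X * Y -> R) :
  measurable V -> measurable_fun setT k ->
  measurable_fun setT (fun x => Rintegral m V (fun y => k (x, y))).
Proof.
move=> mV mk; pose K z := \1_V z.2 * k z.
have mKE : measurable_fun setT (EFin \o K).
  apply/measurable_EFinP/measurable_funM => //.
  exact: measurableT_comp (measurable_indic mV) measurable_snd.
have KE x : (fun y => (k (x, y))%:E) \_ V = (fun y => (K (x, y))%:E).
  apply/funext => y; rewrite /patch /K indicE /=.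
  by case: ifP => _; rewrite ?mul1r ?mul0r.
apply: measurableT_comp (fine_measurable measurableT) _.
under eq_fun do rewrite integral_mkcond KE integralE.
apply: emeasurable_funB.
- have := measurable_fun_fubini_tonelli_F (m2 := m) _ (measurable_funepos mKE)
    (fun z => funepos_ge0 _ z).
  apply: eq_measurable_fun => x _.
  by apply: eq_integral => y _; rewrite !funeposE.
- have := measurable_fun_fubini_tonelli_F (m2 := m) _ (measurable_funeneg mKE)
    (fun z => funeneg_ge0 _ z).
  apply: eq_measurable_fun => x _.
  by apply: eq_integral => y _; rewrite !funenegE.
Qed.

Section complex_exponential.
Variable R : realType.
Local Open Scope complex_scope.
Implicit Types (a : R[i]) (t : R).

Lemma ReM (x y : R[i]) :
  complex.Re (x * y) = (complex.Re x * complex.Re y - complex.Im x * complex.Im y)%R.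
Proof. by case: x => ? ?; case: y. Qed.

Lemma ImM (x y : R[i]) :
  complex.Im (x * y) = (complex.Re x * complex.Im y + complex.Im x * complex.Re y)%R.
Proof. by case: x => ? ?; case: y. Qed.

Lemma eeD t t' : ee (t + t') = ee t * ee t'.
Proof.
rewrite /ee mulrDr cosD sinD.
by apply/eqP; rewrite eq_complex /= eqxx /= addrC eqxx.
Qed.

Let norm_mul_trig_le a u v : `|u| <= 1 -> `|v| <= 1 ->
  (`|complex.Re a * u| + `|complex.Im a * v| <=
   `|complex.Re a| + `|complex.Im a|)%R.
Proof.
move=> u1 v1; rewrite !normrM.
by apply: lerD; rewrite -[leRHS]mulr1; exact: ler_wpM2l.
Qed.

Lemma norm_Re_mul_ee a t :
  (`|complex.Re (a * ee t)| <= `|complex.Re a| + `|complex.Im a|)%R.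
Proof.
rewrite ReM /=; apply: le_trans (ler_normB _ _) _.
by apply: norm_mul_trig_le; [exact: cos_max | exact: sin_max].
Qed.

Lemma norm_Im_mul_ee a t :
  (`|complex.Im (a * ee t)| <= `|complex.Re a| + `|complex.Im a|)%R.
Proof.
rewrite ImM /=; apply: le_trans (ler_normD _ _) _.
by apply: norm_mul_trig_le; [exact: sin_max | exact: cos_max].
Qed.

Lemma measurable_mul_ee d (Y : measurableType d) (a : Y -> R[i]) (phi : Y -> R) :
  measurable_fun setT (fun y => complex.Re (a y)) ->
  measurable_fun setT (fun y => complex.Im (a y)) ->
  measurable_fun setT phi ->
  measurable_fun setT (fun y => complex.Re (a y * ee (phi y))) /\
  measurable_fun setT (fun y => complex.Im (a y * ee (phi y))).
Proof.
move=> mRe mIm mphi.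
have m2piphi : measurable_fun setT (fun y => 2 * pi * phi y) by exact: measurable_funM.
have mcos := measurableT_comp (continuous_measurable_fun (@continuous_cos R)) m2piphi.
have msin := measurableT_comp (continuous_measurable_fun (@continuous_sin R)) m2piphi.
split.
- under eq_fun do rewrite ReM /=.
  by apply: measurable_funB; exact: measurable_funM.
- under eq_fun do rewrite ImM /=.
  by apply: measurable_funD; exact: measurable_funM.
Qed.

Lemma cintegrable_mul_ee n (D : set (Rn R n)) (a : Rn R n -> R[i])
    (phi : Rn R n -> R) :
  measurable D -> cmeasurable a -> cintegrable D a -> measurable_fun setT phi ->
  cintegrable D (fun u => a u * ee (phi u)).
Proof.
move=> mD [mRe mIm] [iRe iIm] mphi.
have [mRe' mIm'] := measurable_mul_ee mRe mIm mphi.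
have iS : (lebn R n).-integrable D
    (fun u => (`|complex.Re (a u)| + `|complex.Im (a u)|)%:E).
  have := integrableD mD (integrable_abse iRe) (integrable_abse iIm).
  by apply: eq_integrable.
split; apply: (le_integrable mD _ _ iS).
- by apply/measurable_EFinP; exact: measurable_funS mRe'.
- move=> u _; rewrite /= lee_fin [leRHS]ger0_norm ?addr_ge0 //.
  exact: norm_Re_mul_ee.
- by apply/measurable_EFinP; exact: measurable_funS mIm'.
- move=> u _; rewrite /= lee_fin [leRHS]ger0_norm ?addr_ge0 //.
  exact: norm_Im_mul_ee.
Qed.

End complex_exponential.

Definition modulate (R : realType) d0 d2 (Q2 : Rn R d0 -> Rn R d2)
    (y : Rn R d2) (h : Rn R d0 -> R[i]) (u : Rn R d0) : R[i] :=
  h u * ee (dotn y (Q2 u)).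

Lemma E2_E1 (R : realType) d0 d1 d2 (Q1 : Rn R d0 -> Rn R d1)
    (Q2 : Rn R d0 -> Rn R d2) V h x y :
  E2 Q1 Q2 V h (x, y) = E1 Q1 V (modulate Q2 y h) x.
Proof.
congr cintegral; apply/funext => u.
by rewrite eeD /modulate -!mulrA [ee _ * _]mulrC.
Qed.

Lemma measurable_cmod_E2 (R : realType) d0 d1 d2 (Q1 : Rn R d0 -> Rn R d1)
    (Q2 : Rn R d0 -> Rn R d2) (V : set (Rn R d0)) (h : Rn R d0 -> R[i]) :
  measurable_fun setT Q1 -> measurable_fun setT Q2 ->
  measurable V -> cmeasurable h ->
  measurable_fun setT (fun x => cmod (E2 Q1 Q2 V h x)).
Proof.
move=> mQ1 mQ2 mV [mRe mIm].
pose phi (xu : ((Rn R d0 * Rn R d1) * Rn R d2) * Rn R d0) :=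
  dotn xu.1.1.1 xu.2 + dotn xu.1.1.2 (Q1 xu.2) + dotn xu.1.2 (Q2 xu.2).
have mphi : measurable_fun setT phi.
  by apply: measurable_funD; first apply: measurable_funD;
    apply: measurable_dotn; do ?exact: measurableT_comp;
    do ?exact: measurable_snd; apply: measurableT_comp => //;
    exact: measurableT_comp.
have [mk1 mk2] := measurable_mul_ee (a := fun xu => h xu.2)
  (measurableT_comp mRe measurable_snd) (measurableT_comp mIm measurable_snd) mphi.
rewrite /cmod /E2 /cintegral /=.
apply: (measurableT_comp (continuous_measurable_fun (@sqrt_continuous R))).
apply: measurable_funD; apply: measurable_funX.
- exact: measurable_fun_Rintegral_snd mV mk1.
- exact: measurable_fun_Rintegral_snd mV mk2.
Qed.

Section extended_minkowski.
Local Open Scope ereal_scope.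
Context d (T : measurableType d) (R : realType).
Variable mu : {measure set T -> \bar R}.
Implicit Types (f g : T -> \bar R) (r : R).

Lemma lee_poweR (x y : \bar R) r : (0 <= r)%R -> 0 <= x -> x <= y ->
  x `^ r <= y `^ r.
Proof.
move=> r0 x0 xy.
by apply: gt0_ler_poweR; rewrite // in_itv /= leey ?x0 ?(le_trans x0 xy).
Qed.

Lemma measurable_poweR_comp f r : measurable_fun setT f ->
  measurable_fun setT (fun x => f x `^ r).
Proof. exact: measurableT_comp (measurable_poweR r). Qed.

Lemma ae_fine_integral_poweR f r : (0 < r)%R ->
  measurable_fun setT f -> (forall x, 0 <= f x) ->
  \int[mu]_x (f x `^ r) != +oo -> {ae mu, forall x, setT x -> f x = (fine (f x))%:E}.
Proof.
move=> r0 mf f0 fr.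
have ifr : mu.-integrable setT (fun x => f x `^ r).
  apply/integrableP; split; first exact: measurable_poweR_comp.
  by under eq_integral do rewrite gee0_abs ?poweR_ge0 //; rewrite ltey.
apply: filterS (integrable_ae measurableT ifr) => x /(_ I) frx _.
rewrite fineK //; move: frx; case: (f x) (f0 x) => //= _.
by rewrite gt_eqF.
Qed.

(* A nonnegative f with a finite integral of f^r is a.e. real, which reduces
   to Minkowski's inequality for real-valued functions. *)
Lemma ge0_eminkowski r f g : (1 <= r)%R ->
  measurable_fun setT f -> measurable_fun setT g ->
  (forall x, 0 <= f x) -> (forall x, 0 <= g x) ->
  (\int[mu]_x ((f x + g x) `^ r)) `^ r^-1 <=
  (\int[mu]_x (f x `^ r)) `^ r^-1 + (\int[mu]_x (g x `^ r)) `^ r^-1.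
Proof.
move=> r1 mf mg f0 g0; have r0 : (0 < r)%R by exact: lt_le_trans r1.
have ri0 : (r^-1 != 0)%R by rewrite invr_neq0 // gt_eqF.
have [->|ffin] := eqVneq (\int[mu]_x (f x `^ r)) +oo.
  by rewrite poweRyr // addye ?leey // gt_eqF // (lt_le_trans _ (poweR_ge0 _ _)).
have [->|gfin] := eqVneq (\int[mu]_x (g x `^ r)) +oo.
  by rewrite poweRyr // addey ?leey // gt_eqF // (lt_le_trans _ (poweR_ge0 _ _)).
have aef := ae_fine_integral_poweR r0 mf f0 ffin.
have aeg := ae_fine_integral_poweR r0 mg g0 gfin.
pose f' x := fine (f x); pose g' x := fine (g x).
have mf' : measurable_fun setT f' by exact: measurableT_comp mf.
have mg' : measurable_fun setT g' by exact: measurableT_comp mg.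
have int_fine (k : T -> \bar R) (k' : T -> R) : measurable_fun setT k ->
    measurable_fun setT k' -> (forall x, 0 <= k' x)%R ->
    {ae mu, forall x, setT x -> k x = (k' x)%:E} ->
    \int[mu]_x (k x `^ r) = \int[mu]_x (`|k' x|%:E `^ r).
  move=> mk mk' k'0 aek; apply: ae_eq_integral => //.
  - exact: measurable_poweR_comp.
  - by apply/measurable_poweR_comp/measurable_EFinP; exact: measurableT_comp.
  by apply: filterS aek => x kx _; rewrite kx // ger0_norm.
have f'0 x : (0 <= f' x)%R by exact: fine_ge0.
have g'0 x : (0 <= g' x)%R by exact: fine_ge0.
rewrite (int_fine f f') // (int_fine g g') //.
rewrite (int_fine (fun x => f x + g x) (f' \+ g')%R).
- by have := minkowski_EFin mu mf' mg' r1; rewrite unlock.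
- exact: emeasurable_funD.
- exact: measurable_funD.
- by move=> x; rewrite addr_ge0.
- by apply: filterS2 aef aeg => x fx gx _; rewrite fx // gx.
Qed.

Lemma ge0_eminkowski_sum r (I : Type) (s : seq I) (F : I -> T -> \bar R) :
  (1 <= r)%R -> (forall i, measurable_fun setT (F i)) ->
  (forall i x, 0 <= F i x) ->
  (\int[mu]_x ((\sum_(i <- s) F i x) `^ r)) `^ r^-1 <=
  \sum_(i <- s) (\int[mu]_x (F i x `^ r)) `^ r^-1.
Proof.
move=> r1 mF F0; have r0 : (0 < r)%R by exact: lt_le_trans r1.
elim: s => [|a s IH].
  rewrite big_nil; under eq_integral do rewrite big_nil poweR0r ?gt_eqF //.
  by rewrite integral0 poweR0r ?invr_neq0 ?gt_eqF.
rewrite big_cons; under eq_integral do rewrite big_cons.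
apply: le_trans (ge0_eminkowski r1 _ _ _ _) _ => //.
- exact: emeasurable_sum.
- by move=> x; apply: sume_ge0.
- exact: leeD.
Qed.

End extended_minkowski.

Lemma ge0_le_neg_mule_eq0 (R : realType) (C : R) (a b : \bar R) : (C < 0)%R ->
  (0 <= a)%E -> (0 <= b)%E -> (a <= C%:E * b)%E -> b = 0%E.
Proof.
move=> C0 a0 b0 abC; apply/eqP; rewrite eq_le b0 andbT leNgt; apply/negP => b_gt0.
have : (0 < 0 :> \bar R)%E.
  by apply: le_lt_trans (le_trans a0 abC) (mule_lt0_gt0 _ b_gt0); rewrite lte_fin.
by rewrite ltxx.
Qed.

Section integrated_decoupling.
Local Open Scope ereal_scope.
Context d (T : measurableType d) (R : realType).
Variable mu : {measure set T -> \bar R}.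
Variables (p q C : R) (l : nat) (I0 : T -> \bar R) (I : 'I_l -> T -> \bar R).
Hypotheses (q_ge1 : (1 <= q)%R) (q_le_p : (q <= p)%R).
Hypotheses (mI0 : measurable_fun setT I0) (mI : forall i, measurable_fun setT (I i)).
Hypotheses (I0_ge0 : forall x, 0 <= I0 x) (I_ge0 : forall i x, 0 <= I i x).
Hypothesis decoupling : forall x,
  I0 x `^ p^-1 <= C%:E * (\sum_(i < l) (I i x `^ p^-1) `^ q) `^ q^-1.

Let q_gt0 : (0 < q)%R. Proof. exact: lt_le_trans q_ge1. Qed.
Let p_gt0 : (0 < p)%R. Proof. exact: lt_le_trans q_le_p. Qed.
Let p_neq0 : (p != 0)%R. Proof. by rewrite gt_eqF. Qed.
Let q_neq0 : (q != 0)%R. Proof. by rewrite gt_eqF. Qed.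
Let pinv_neq0 : (p^-1 != 0)%R. Proof. by rewrite invr_neq0. Qed.
Let qinv_neq0 : (q^-1 != 0)%R. Proof. by rewrite invr_neq0. Qed.

Let decoupling_neg_trivial x : (C < 0)%R -> I0 x = 0 /\ forall i, I i x = 0.
Proof.
move=> C_lt0; pose S := \sum_(i < l) (I i x `^ p^-1) `^ q.
have S_ge0 : 0 <= S by apply: sume_ge0 => i _; exact: poweR_ge0.
have Sq0 : S `^ q^-1 = 0.
  exact: ge0_le_neg_mule_eq0 C_lt0 (poweR_ge0 _ _) (poweR_ge0 _ _) (decoupling x).
have S0 : S = 0 := poweR_eq0_eq0 S_ge0 Sq0.
split.
  apply: (poweR_eq0_eq0 (I0_ge0 x)); apply/eqP; rewrite eq_le poweR_ge0 andbT.
  by apply: le_trans (decoupling x) _; rewrite -/S Sq0 mule0.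
move=> i; apply: (poweR_eq0_eq0 (I_ge0 i x)); apply: poweR_eq0_eq0 (poweR_ge0 _ _) _.
apply/eqP; rewrite eq_le poweR_ge0 andbT -S0 /S (bigD1 i) //=.
by apply: leeDl; apply: sume_ge0 => j _; exact: poweR_ge0.
Qed.

Let r := (p / q)%R.
Let r_ge1 : (1 <= r)%R. Proof. by rewrite ler_pdivlMr // mul1r. Qed.
Let r_gt0 : (0 < r)%R. Proof. exact: lt_le_trans r_ge1. Qed.

Let F i x := (I i x `^ p^-1) `^ q.
Let F_powr i x : F i x `^ r = I i x.
Proof.
rewrite /F -!poweRrM (_ : (p^-1 * (q * r) = 1)%R) ?poweRe1 //.
by rewrite /r; field; exact/andP.
Qed.

Let decoupling_pow x : (0 <= C)%R ->
  I0 x <= C%:E `^ p * (\sum_(i < l) F i x) `^ r.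
Proof.
move=> C_ge0; have := lee_poweR (ltW p_gt0) (poweR_ge0 _ _) (decoupling x).
rewrite -poweRrM mulVf // poweRe1 // => /le_trans; apply.
by rewrite poweRM ?poweR_ge0 ?lee_fin // -poweRrM mulrC.
Qed.

Let mF i : measurable_fun setT (F i).
Proof. by apply: measurable_poweR_comp; exact: measurable_poweR_comp. Qed.

Let F_ge0 i x : 0 <= F i x. Proof. exact: poweR_ge0. Qed.

Let Ts := \sum_(i < l) ((\int[mu]_x I i x) `^ p^-1) `^ q.

Let minkowski_F : \int[mu]_x ((\sum_(i < l) F i x) `^ r) <= Ts `^ r.
Proof.
have := ge0_eminkowski_sum mu (index_enum 'I_l) r_ge1 mF F_ge0.
under [X in _ <= X]eq_bigr do under eq_integral do rewrite F_powr.
move/(lee_poweR (ltW r_gt0) (poweR_ge0 _ _)).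
rewrite -poweRrM mulVf ?gt_eqF // poweRe1; last first.
  by apply: integral_ge0 => x _; exact: poweR_ge0.
move=> /le_trans; apply; apply: lee_poweR (ltW r_gt0) _ _.
  by apply: sume_ge0 => i _; exact: poweR_ge0.
apply: lee_sum => i _; rewrite -poweRrM (_ : (r^-1 = p^-1 * q)%R) //.
by rewrite /r; field; exact/andP.
Qed.

Let integral_I0_le : (0 <= C)%R -> \int[mu]_x I0 x <= C%:E `^ p * Ts `^ r.
Proof.
move=> C_ge0; apply: le_trans (lee_wpmul2l (poweR_ge0 _ _) minkowski_F).
have mSr : measurable_fun setT (fun x => (\sum_(i < l) F i x) `^ r).
  by apply: measurable_poweR_comp; exact: emeasurable_sum.
rewrite -ge0_integralZl //; last 2 first.
- by move=> x _; exact: poweR_ge0.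
- exact: poweR_ge0.
apply: ge0_le_integral => //; last by move=> x _; exact: decoupling_pow.
by apply: emeasurable_funM => //; exact: measurable_cst.
Qed.

Lemma le_integral_decoupling :
  (\int[mu]_x I0 x) `^ p^-1 <=
  C%:E * (\sum_(i < l) ((\int[mu]_x I i x) `^ p^-1) `^ q) `^ q^-1.
Proof.
have [C_lt0|C_ge0] := ltP C 0%R.
  under eq_integral do rewrite (decoupling_neg_trivial _ C_lt0).1.
  under eq_bigr do under eq_integral do rewrite (decoupling_neg_trivial _ C_lt0).2.
  rewrite integral0 poweR0r // big1 => [|i _]; last by rewrite !poweR0r.
  by rewrite poweR0r // mule0.
have pinv_ge0 : (0 <= p^-1)%R by rewrite invr_ge0 ltW.
have := lee_poweR pinv_ge0 (integral_ge0 _ (fun x _ => I0_ge0 x)) (integral_I0_le C_ge0).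
move=> /le_trans; apply.
rewrite poweRM ?poweR_ge0 // -!poweRrM mulfV // poweRe1 ?lee_fin //.
by rewrite (_ : (r / p = q^-1)%R) // /r; field; exact/andP.
Qed.

End integrated_decoupling.

Section slices.
Local Open Scope ereal_scope.
Variables (R : realType) (p : R) (d0 d1 d2 : nat).
Variables (Q1 : Rn R d0 -> Rn R d1) (Q2 : Rn R d0 -> Rn R d2).
Variables (B : set (Rn R d0 * Rn R d1)) (B' : set (Rn R d2)) (h : Rn R d0 -> R[i]).
Hypotheses (p_gt0 : (0 < p)%R) (mB : measurable B) (mB' : measurable B').
Hypotheses (mQ1 : measurable_fun setT Q1) (mQ2 : measurable_fun setT Q2).
Hypothesis mh : cmeasurable h.

Let m01 := pmeas (lebn R d0) (lebn R d1).

Let integrand V (x : (Rn R d0 * Rn R d1) * Rn R d2) :=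
  `|(\1_(B `*` B') x * cmod (E2 Q1 Q2 V h x))%:E| `^ p.

Let measurable_integrand V : measurable V -> measurable_fun setT (integrand V).
Proof.
move=> mV; apply: measurable_poweR_comp.
apply: measurableT_comp (@abse_measurable R setT) _.
apply/measurable_EFinP/measurable_funM.
  exact: measurable_indic (measurableX mB mB').
exact: measurable_cmod_E2.
Qed.

Definition slice_norm_pow V y := \int[m01]_x integrand V (x, y).

Lemma LpnormC_E2_slices V : measurable V ->
  LpnormC (pmeas m01 (lebn R d2)) p (B `*` B') (E2 Q1 Q2 V h) =
  (\int[lebn R d2]_y slice_norm_pow V y) `^ p^-1.
Proof.
move=> mV; rewrite /LpnormC unlock; congr (_ `^ _).
exact: fubini_tonelli2 (measurable_integrand mV) (fun _ => poweR_ge0 _ _).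
Qed.

Lemma measurable_slice_norm_pow V : measurable V ->
  measurable_fun setT (slice_norm_pow V).
Proof.
move=> mV; exact: (measurable_fun_fubini_tonelli_G (m1 := m01) _
  (measurable_integrand mV) (fun _ => poweR_ge0 _ _)).
Qed.

Lemma slice_norm_pow_ge0 V y : 0 <= slice_norm_pow V y.
Proof. by apply: integral_ge0 => x _; exact: poweR_ge0. Qed.

Lemma slice_norm_powE V y : B' y ->
  slice_norm_pow V y = LpnormC m01 p B (E1 Q1 V (modulate Q2 y h)) `^ p.
Proof.
move=> B'y; rewrite /LpnormC poweR_Lnorm; last by rewrite gt_eqF.
apply: eq_integral => x _.
by rewrite /integrand indic_setX [\1_B' y]indicE (mem_set B'y) mulr1 E2_E1.
Qed.

Lemma slice_norm_pow_root V y : B' y ->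
  slice_norm_pow V y `^ p^-1 = LpnormC m01 p B (E1 Q1 V (modulate Q2 y h)).
Proof.
move=> B'y; rewrite slice_norm_powE // -poweRrM mulfV ?gt_eqF // poweRe1 //.
exact: Lnorm_ge0.
Qed.

Lemma slice_norm_pow_out V y : ~ B' y -> slice_norm_pow V y = 0.
Proof.
move=> nB'y; rewrite /slice_norm_pow /integrand.
under eq_integral do
  rewrite indic_setX [\1_B' y]indicE memNset // mulr0 mul0r abse0 poweR0r ?gt_eqF //.
exact: integral0.
Qed.

End slices.

Theorem lemma3p1 (R : realType) (p q : R) (d0 d1 d2 l : nat)
  (Q1 : Rn R d0 -> Rn R d1) (Q2 : Rn R d0 -> Rn R d2)
  (U : 'I_l -> set (Rn R d0)) (B : set (Rn R d0 * Rn R d1)) (C : R) :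
  1 <= q -> q <= p ->
  measurable_fun setT Q1 -> measurable_fun setT Q2 ->
  (forall i, measurable (U i)) ->
  trivIset setT U ->
  \bigcup_(i in setT) U i = cube R d0 ->
  measurable B ->
  (forall g : Rn R d0 -> R[i], cmeasurable g -> cintegrable (cube R d0) g ->
     (LpnormC (pmeas (lebn R d0) (lebn R d1)) p B (E1 Q1 (cube R d0) g)
      <= C%:E * (\sum_(i < l)
           LpnormC (pmeas (lebn R d0) (lebn R d1)) p B (E1 Q1 (U i) g) `^ q)
          `^ q^-1)%E) ->
  forall (B' : set (Rn R d2)) (h : Rn R d0 -> R[i]),
    measurable B' -> cmeasurable h -> cintegrable (cube R d0) h ->
    (LpnormC (pmeas (pmeas (lebn R d0) (lebn R d1)) (lebn R d2)) p (B `*` B')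
       (E2 Q1 Q2 (cube R d0) h)
     <= C%:E * (\sum_(i < l)
          LpnormC (pmeas (pmeas (lebn R d0) (lebn R d1)) (lebn R d2)) p (B `*` B')
            (E2 Q1 Q2 (U i) h) `^ q) `^ q^-1)%E.
Proof.
move=> q_ge1 q_le_p mQ1 mQ2 mU _ _ mB decoupling1 B' h mB' mh ih.
have p_gt0 : 0 < p by apply: lt_le_trans q_le_p; exact: lt_le_trans q_ge1.
have mcube := measurable_cube R d0.
rewrite (LpnormC_E2_slices p mB mB' mQ1 mQ2 mh mcube).
under eq_bigr do rewrite (LpnormC_E2_slices p mB mB' mQ1 mQ2 mh (mU _)).
apply: (le_integral_decoupling _ q_ge1 q_le_p).
- exact: measurable_slice_norm_pow.
- by move=> i; exact: measurable_slice_norm_pow.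
- by move=> y; exact: slice_norm_pow_ge0.
- by move=> i y; exact: slice_norm_pow_ge0.
move=> y; have [B'y|nB'y] := pselect (B' y).
  have root V := slice_norm_pow_root Q1 Q2 B h p_gt0 V B'y.
  rewrite [X in (X <= _)%E]root.
  under eq_bigr do rewrite root.
  have [mRe mIm] := mh; have mdot := measurable_dotn (measurable_cst y) mQ2.
  apply: decoupling1; first exact: measurable_mul_ee.
  exact: cintegrable_mul_ee.
have q_gt0 : 0 < q by exact: lt_le_trans q_ge1.
have [pinv_neq0 q_neq0] : p^-1 != 0 /\ q != 0 by rewrite invr_neq0 ?gt_eqF.
have out V := slice_norm_pow_out Q1 Q2 B h p_gt0 V nB'y.
rewrite [X in (X `^ _ <= _)%E]out poweR0r // big1 => [|i _].
  by rewrite poweR0r ?mule0 // invr_neq0.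
by rewrite out !poweR0r.
Qed.
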